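(* Given any metric space $(X,d)$, we have $$\sup_{r,\mu}\|A_{r,\mu}\|_{L^1\to L^1}\le \sup_{\mu}\|M_\mu\|_{L^1\to L^{1,\infty}},$$ where the supremum on the left hand side is taken over all $r>0$ and all $\tau$-additive, locally finite Borel measures $\mu$ on $X$, and the supremum on the right over all such $\mu$ (both suprema are allowed to be $\infty$).
   Context: Metric spaces are assumed to have at least two points; all measures are assumed to be not identically zero. Balls: $B^{o}(x,r)=\{y\in X: d(x,y)<r\}$ (open) and $B^{cl}(x,r)=\{y\in X: d(x,y)\le r\}$ (closed), $r>0$. The notation $B(x,r)$ means that all balls are of the same kind, i.e. all open or all closed (the same choice in every definition below). Measures: a Borel measure $\mu$ on $X$ is $\tau$-additive if for every collection $\{O_\alpha:\alpha\in\Lambda\}$ of open sets, $\mu(\bigcup_\alpha O_\alpha)=\sup \mu(\bigcup_{i=1}^n O_{\alpha_i})$, the supremum being over all finite subcollections $\{O_{\alpha_1},\dots,O_{\alpha_n}\}$. It is locally finite if it assigns finite measure to bounded Borel sets. The support of $\mu$ is the complement of $\bigcup\{B^{o}(x,r): x\in X,\ r>0,\ \mu B^{o}(x,r)=0\}$; for $\tau$-additive, locally finite $\mu$ the complement of the support has measure zero. Averaging operators: for $r>0$, $g$ locally integrable and $x\in\operatorname{supp}\mu$, $A_{r,\mu}g(x):=\frac{1}{\mu(B(x,r))}\int_{B(x,r)}g\,d\mu$. $\|A_{r,\mu}\|_{L^1\to L^1}$ is the smallest $c$ with $\|A_{r,\mu}g\|_{L^1(\mu)}\le c\|g\|_{L^1(\mu)}$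 for all $g\in L^1(\mu)$ (and $\infty$ if there is none). Centered maximal operator: $M_\mu g(x):=\sup_{r>0}A_{r,\mu}|g|(x)$ for $x\in\operatorname{supp}\mu$. $\|M_\mu\|_{L^1\to L^{1,\infty}}$ is the smallest $c$ with $\mu(\{M_\mu g\ge\alpha\})\le c\|g\|_{L^1(\mu)}/\alpha$ for all $g\in L^1(\mu)$ and all $\alpha>0$ (and $\infty$ if there is none). *)

(* Defs.v *)
From HB Require Import structures.
From mathcomp Require Import all_boot all_order all_algebra.
From mathcomp Require Import all_classical all_reals all_analysis.

Set Implicit Arguments.
Unset Strict Implicit.
Unset Printing Implicit Defensive.

Import Order.TTheory GRing.Theory Num.Theory.
Import numFieldNormedType.Exports.

Local Open Scope classical_set_scope.
Local Open Scope ring_scope.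

(* [g_sigma_algebraType] requires a pointed carrier, hence this join; the point
   itself plays no role, and every nonempty metric space has one. *)
#[short(type="pmetricType")]
HB.structure Definition PointedMetric (K : numDomainType) :=
  { M of Metric K M & isPointed M }.

Definition borel {R : realType} (X : pmetricType R) :=
  g_sigma_algebraType (@open X).

Variant ball_kind := OpenBalls | ClosedBalls.

Section measures.
Context {R : realType} (X : pmetricType R).
Implicit Types (mu : {measure set (borel X) -> \bar R}) (A : set X).
Local Open Scope ereal_scope.

(* The library's [closed_ball] is the closure of the open ball, which can be
   strictly smaller than [[set y | mdist x y <= r]]. *)
Definition mball (k : ball_kind) (x : X) (r : R) : set X :=
  match k with
  | OpenBalls => [set y | (mdist x y < r)%R]
  | ClosedBalls => [set y | (mdist x y <= r)%R]
  end.

Definition metric_bounded A :=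
  exists M : R, forall x y, A x -> A y -> (mdist x y <= M)%R.

Definition tau_additive mu :=
  forall C : set (set X), (forall O, C O -> open O) ->
    mu (\bigcup_(O in C) O) =
    ereal_sup [set mu (\bigcup_(O in D) O) | D in
                 [set D : set (set X) | finite_set D /\ D `<=` C]].

Definition locally_finite mu :=
  forall A : set (borel X), measurable A -> metric_bounded A -> mu A < +oo.

Definition admissible : set ({measure set (borel X) -> \bar R}) :=
  [set mu : {measure set (borel X) -> \bar R} |
    [/\ mu setT != 0, tau_additive mu & locally_finite mu]].

Definition msupport mu : set X :=
  ~` \bigcup_(B in [set B | exists x r,
        [/\ (0 < r)%R, B = mball OpenBalls x r & mu B = 0]]) B.

End measures.

Section operators.
Context {R : realType} (X : pmetricType R).
Variables (k : ball_kind) (mu : {measure set (borel X) -> \bar R}).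
Implicit Types (g : borel X -> R) (x : X).
Local Open Scope ereal_scope.

(* The next two operators are meant at points of the support only: there, for
   a locally finite measure, the balls have measure in ]0, +oo[. Elsewhere
   their values are irrelevant. *)
Definition average (r : R) g x : \bar R :=
  (mu (mball k x r))^-1 * \int[mu]_(y in mball k x r) (g y)%:E.

Definition maximal g x : \bar R :=
  ereal_sup [set average r (fun y => `|g y|%R) x | r in [set r | (0 < r)%R]].

(* In both norms, the least constant is an infimum in [\bar R], so that it is
   [+oo] when there is no constant. *)
Definition average_norm (r : R) : \bar R :=
  ereal_inf [set c%:E | c in [set c : R | (0 <= c)%R /\
    forall g, mu.-integrable setT (EFin \o g) ->
      'N[mu]_1[(average r g : borel X -> \bar R) \_ (msupport mu)]
        <= c%:E * 'N[mu]_1[EFin \o g]]].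

Definition maximal_weak_norm : \bar R :=
  ereal_inf [set c%:E | c in [set c : R | (0 <= c)%R /\
    forall g (alpha : R), mu.-integrable setT (EFin \o g) -> (0 < alpha)%R ->
      mu [set x | msupport mu x /\ alpha%:E <= maximal g x]
        <= c%:E * 'N[mu]_1[EFin \o g] / alpha%:E]].

End operators.

(* Main.v *)
From HB Require Import structures.
Require Import Defs.
From mathcomp Require Import all_boot all_order all_algebra.
From mathcomp Require Import all_classical all_reals all_analysis.
From mathcomp Require Import measurable_realfun ring lra.

(* Both sides are compared with the largest number of points x_1, ..., x_n
   that lie in a common ball of radius r while no B(x_i, r) contains another
   x_j.

   If y lies in all the B(x_i, r), the measure e delta_y + sum_i delta_(x_i) and
   the function 1_{y}, whose averages over the B(x_i, r) are all e / (1 + e),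
   show that some weak-type norm is at least n / (1 + e); let e -> 0.

   Conversely, by Tonelli the strong-type norm of the averages is at most the
   supremum over y of the integral of 1 / mu(B(x, r)) over x in B(y, r).  Pick
   x_1 in B(y, r) almost minimizing mu(B(x, r)): the integral over
   B(y, r) n B(x_1, r) is almost at most 1.  Pick x_2 likewise in the part of
   B(y, r) outside B(x_1, r), and so on; this stops after at most n steps. *)

Set Implicit Arguments.
Unset Strict Implicit.
Unset Printing Implicit Defensive.

Import Order.TTheory GRing.Theory Num.Theory.
Import numFieldNormedType.Exports.

Local Open Scope classical_set_scope.
Local Open Scope ring_scope.

(** * Elementary facts on balls and their Borel measurability *)

Section balls.
Context {R : realType} (X : pmetricType R).
Implicit Types (x y : X) (r : R) (k : ball_kind).

Lemma mball_sym k x y r : mball k x r y -> mball k y r x.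
Proof. by case: k; rewrite /= metric_sym. Qed.

Lemma mball_center k x r : 0 < r -> mball k x r x.
Proof. by case: k => r0; rewrite /= mdistxx// ltW. Qed.

Lemma mball_openW k x r : mball OpenBalls x r `<=` mball k x r.
Proof. by case: k => // y /= /ltW. Qed.

Lemma open_measurable_borel (A : set X) : open A -> measurable (A : set (borel X)).
Proof. by move=> oA; exact: sub_gen_smallest. Qed.

Lemma open_mball x r : open (mball OpenBalls x r).
Proof.
rewrite openE => y /= xyr; apply/nbhs_ballP.
exists (r - mdist x y) => /=; first by rewrite subr_gt0.
rewrite ballEmdist => z /=; have := metric_triangle x y z; lra.
Qed.

Lemma closed_mballE x r :
  mball ClosedBalls x r = \bigcap_n mball OpenBalls x (r + n.+1%:R^-1).
Proof.
apply/seteqP; split => [y /= xyr n _ /=|y /= xyr].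
  by rewrite (le_lt_trans xyr)// ltrDl invr_gt0.
rewrite leNgt; apply/negP => rxy.
have [n nxy] := ltr_add_invr rxy.
by have /= := xyr n I; rewrite ltNge (ltW nxy).
Qed.

Lemma measurable_mball k x r : measurable (mball k x r : set (borel X)).
Proof.
case: k; first exact: (open_measurable_borel (@open_mball _ _)).
rewrite closed_mballE; apply: bigcap_measurable => // n _.
exact: (open_measurable_borel (@open_mball _ _)).
Qed.

Lemma measurable_singleton x : measurable ([set x] : set (borel X)).
Proof.
have -> : [set x] = mball ClosedBalls x 0.
  apply/seteqP; split => [y -> /=|y /=]; first by rewrite mdistxx.
  move=> xy; apply/esym/mdist_positivity/eqP; rewrite eq_le xy; exact: mdist_ge0.
exact: measurable_mball.
Qed.

End balls.

(** * Discrete test measures and the lower bound for the weak-type norms *)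

Section star_measure.
Context {R : realType} (X : pmetricType R).
Implicit Types (x y : X) (r : R) (k : ball_kind) (s : seq X).

Definition besicovitch_centers k r s :=
  uniq s /\ {in s &, forall x y, mball k x r y -> x = y}.

Definition star_measure (e : {nonneg R}) y s : {measure set (borel X) -> \bar R} :=
  measure_add (mscale e (dirac (y : borel X)))
    (msum (fun i => dirac (nth y s i : borel X)) (size s)).

Lemma star_measureE e y s (A : set X) : star_measure e y s A =
  (e%:num * (y \in A)%:R + (count (fun x => x \in A) s)%:R)%:E.
Proof.
rewrite [LHS](_ : _ = mscale e (dirac (y : borel X)) A +
    msum (fun i => dirac (nth y s i : borel X)) (size s) A)%E;
  last exact: measure_addE.
rewrite /mscale /msum /= EFinD; congr (_ + _)%E.
rewrite -sum1_count natr_sum -sumEFin (big_nth y) big_mkord [RHS]big_mkcond/=.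
by apply: eq_bigr => i _; rewrite diracE; case: ifP.
Qed.

(** All the mass sits on [y :: s]. For tau-additivity this reduces comparing a union with a finite
    subunion to finitely many points. *)
Lemma star_measure_le e y s (A B : set X) :
  {in y :: s, forall x, A x -> B x} ->
  (star_measure e y s A <= star_measure e y s B)%E.
Proof.
move=> AB; rewrite !star_measureE lee_fin; apply: lerD.
  apply: ler_wpM2l => //; rewrite ler_nat.
  case: (boolP (y \in A)) => // /set_mem/(AB y (mem_head _ _)) By.
  by rewrite mem_set.
rewrite ler_nat -!size_filter.
rewrite (_ : [seq x <- s | x \in A] = [seq x <- [seq x <- s | x \in B] | x \in A]).
  by rewrite size_filter count_size.
rewrite -filter_predI; apply: eq_in_filter => x xs /=.
case: (boolP (x \in A)) => //= /set_mem/AB xB; rewrite mem_set//.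
by apply: xB; rewrite inE xs orbT.
Qed.

Lemma star_measure_admissible (e : {nonneg R}) y s :
  0 < e%:num -> admissible (star_measure e y s).
Proof.
move=> e0; split.
- rewrite star_measureE in_setT eqe gt_eqF //.
  by rewrite ltr_wpDr ?mulr1.
- move=> C _; apply/eqP; rewrite eq_le; apply/andP; split; last first.
    apply: ge_ereal_sup => _ [D [_ DC] <-].
    apply: star_measure_le => x _ [U DU Ux].
    by exists U => //; exact: DC.
  (* One member of [C] for each atom that the union covers: this finite subfamily already has the
     full mass of the union. *)
  pose sel x := xget set0 [set U | C U /\ U x].
  pose P := [set x | x \in y :: s /\ (\bigcup_(U in C) U) x].
  have selP x : P x -> C (sel x) /\ sel x x.
    by move=> [_ [U CU Ux]]; apply: (@xgetPex _ set0 [set U | C U /\ U x]); exists U.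
  apply: le_ereal_sup_tmp; exists (star_measure e y s (\bigcup_(U in sel @` P) U)).
    exists (sel @` P) => //; split; last by move=> _ [x /selP[? _] <-].
    apply: finite_image; apply: (@sub_finite_set _ _ [set` y :: s]).
      by move=> x [].
    exact: finite_seq.
  apply: star_measure_le => x xs Cx; have [_ selx] := selP x (conj xs Cx).
  by exists (sel x) => //; exists x.
- by move=> A _ _; rewrite star_measureE ltry.
Qed.

Lemma star_measure_support (e : {nonneg R}) y s : 0 < e%:num ->
  {in y :: s, forall x, msupport (star_measure e y s) x}.
Proof.
move=> e0 x xs [B [z [r [r0 -> /eqP]]]]; rewrite star_measureE.
move=> + zx; rewrite eqe paddr_eq0 ?mulr_ge0// mulf_eq0 gt_eqF//=.
rewrite !pnatr_eq0 eqb0 => /andP[ynB /eqP sB].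
move: xs; rewrite inE => /predU1P[xy|xs].
  by move: ynB; rewrite -xy mem_set.
move: (has_count (fun x => x \in mball OpenBalls z r) s); rewrite sB ltnn.
by move=> /negbT/hasPn/(_ x xs)/negP; apply; rewrite mem_set.
Qed.

(* [B(x, r)] has mass [1 + e] for every [x] in [s], as it contains no point of
   [s] but [x]. *)
Lemma star_measure_weak_norm (e : {nonneg R}) k r y s : 0 < e%:num -> 0 < r ->
  besicovitch_centers k r s -> y \notin s -> {in s, forall x, mball k x r y} ->
  (((size s)%:R / (1 + e%:num))%:E <= maximal_weak_norm k (star_measure e y s))%E.
Proof.
move=> e0 r0 [us seps] ys sy; set mu := star_measure e y s.
have e10 : 0 < 1 + e%:num by rewrite addr_gt0.
apply: le_ereal_inf_tmp => _ [c [c0 +] <-].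
have my : mu [set y] = e%:num%:E.
  rewrite star_measureE mem_set// mulr1 (_ : count _ _ = 0%N) ?addr0//.
  apply/eqP; rewrite -leqn0 leqNgt -has_count; apply/hasPn => x xs.
  by apply: contra ys => /set_mem <-.
pose g := \1_[set y] : borel X -> R.
have g0 z : 0 <= g z by rewrite /g indicE.
have Ng : ('N[mu]_1[EFin \o g] = e%:num%:E)%E.
  rewrite Lnorm1 -my -[[set y] in RHS]setIT -integral_indic//; last first.
    exact: measurable_singleton.
  by apply: eq_integral => x _ /=; rewrite ger0_norm// indicE.
have avg x : x \in s -> average k mu r (fun z => `|g z|) x = (e%:num / (1 + e%:num))%:E.
  move=> xs; rewrite /average.
  under eq_integral do rewrite ger0_norm//.
  rewrite /g integral_indic; [|exact: measurable_mball|exact: measurable_singleton].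
  rewrite (_ : _ `&` _ = [set y]); last first.
    by apply/setIidl => _ ->; exact: sy.
  rewrite my star_measureE mem_set; last exact: sy.
  rewrite (_ : count _ _ = count_mem x s); last first.
    apply: eq_in_count => z zs /=; apply/idP/eqP => [/set_mem/(seps x z xs zs)//|->].
    by rewrite mem_set//; exact: mball_center.
  rewrite count_uniq_mem// xs mulr1 inver addrC gt_eqF//.
  by rewrite -EFinM mulrC.
have ig : mu.-integrable setT (EFin \o g).
  apply/integrableP; split; last by move: Ng; rewrite Lnorm1 => ->; rewrite ltry.
  by apply/measurable_EFinP; apply: measurable_indic; exact: measurable_singleton.
(* The level is the common value of the averages over the [B(x, r)], so the superlevel set contains
   all of [s]. *)
move=> /(_ g (e%:num / (1 + e%:num)) ig); rewrite divr_gt0// => /(_ isT).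
rewrite Ng inver gt_eqF ?divr_gt0// -!EFinM invf_div.
set S := [set x | _]; move=> muS.
have : ((size s)%:R%:E <= mu S)%E.
  rewrite star_measureE lee_fin; apply: ler_wpDl; first by rewrite mulr_ge0.
  rewrite ler_nat -count_predT; apply: eq_leq; apply: eq_in_count => x xs /=.
  rewrite mem_set//; split.
    by apply: star_measure_support => //; rewrite inE xs orbT.
  by rewrite -(avg x xs); apply: ereal_sup_ubound; exists r.
move=> /le_trans/(_ muS); rewrite !lee_fin.
by rewrite ler_pdivrMr// (_ : _ * _ = c * (1 + e%:num))//; field; rewrite !gt_eqF.
Qed.

End star_measure.

Lemma besicovitch_centers_size_le {R : realType} (X : pmetricType R)
    (hX : exists x y : X, x != y) (k : ball_kind) (S : R) :
  (forall mu, @admissible R X mu -> (maximal_weak_norm k mu <= S%:E)%E) ->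
  forall (r : R) (y : X) (s : seq X), 0 < r -> besicovitch_centers k r s ->
    {in s, forall x, mball k x r y} -> (size s)%:R <= S.
Proof.
move=> muS.
have main r (y : X) s : 0 < r -> besicovitch_centers k r s -> y \notin s ->
    {in s, forall x, mball k x r y} -> (size s)%:R <= S.
  move=> r0 seps ys sy; rewrite leNgt; apply/negP => Ss.
  have weak (e : R) (e0 : 0 < e) : (size s)%:R <= S * (1 + e).
    pose e' := NngNum (ltW e0).
    rewrite -ler_pdivrMr ?addr_gt0// -lee_fin.
    apply: le_trans (muS _ (@star_measure_admissible _ _ e' y s e0)).
    exact: (@star_measure_weak_norm _ _ e' k r y s e0 r0 seps ys sy).
  have S0 : 0 <= S.
    have := weak 1 ltr01; have : 0 <= (size s)%:R :> R by []. 
    lra.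
  (* With [e] equal to this number, [S * e] is at most half of the gap [size s - S], which
     contradicts [weak]. *)
  have d0 : 0 < ((size s)%:R - S) / (S + 1) / 2.
    by rewrite !divr_gt0// ?subr_gt0// ltr_wpDl.
  have := weak _ d0.
  set d := _ / 2 in d0 *.
  have : d * (S + 1) * 2 = (size s)%:R - S.
    by rewrite /d; field; rewrite gt_eqF// ltr_wpDl.
  have : 0 <= S * d by rewrite mulr_ge0// ltW.
  lra.
move=> r y s r0 seps sy; have [ys|ys] := boolP (y \in s); last exact: main ys sy.
have s1 : (size s <= 1)%N.
  apply: (@uniq_leq_size _ s [:: y]); first exact: seps.1.
  by move=> x xs; rewrite inE; apply/eqP/seps.2 => //; exact: sy.
(* Here [s] is [:: y], so another pair of points can serve as [y] and [s]. *)
have [a [b ab]] := hX.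
apply: (@le_trans _ _ 1); first by rewrite (ler_nat _ _ 1).
apply: (@main (mdist a b + 1) b [:: a]).
- by rewrite ltr_wpDl// mdist_ge0.
- by split => // x z; rewrite !inE => /eqP -> /eqP ->.
- by rewrite inE eq_sym.
- by move=> x; rewrite inE => /eqP ->; apply: mball_openW => /=; rewrite ltrDl.
Qed.

(** * The support: full measure and separability *)

Section support.
Context {R : realType} (X : pmetricType R).
Variable mu : {measure set (borel X) -> \bar R}.
Hypothesis amu : admissible mu.

Lemma mball_finite k (x : X) r : (mu (mball k x r) < +oo)%E.
Proof.
have [_ _ lmu] := amu; apply: lmu; first exact: measurable_mball.
exists (2 * r) => y z.
have h w : mball k x r w -> mdist x w <= r by case: k => //= /ltW.
move=> /h xy /h xz.
by have := metric_triangle y x z; rewrite (metric_sym y x); lra.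
Qed.

Lemma msupport_mball_gt0 k (x : X) r : 0 < r -> msupport mu x ->
  (0 < mu (mball k x r))%E.
Proof.
move=> r0 xmu; rewrite lt0e measure_ge0 andbT; apply/eqP => mu0.
apply: xmu; exists (mball OpenBalls x r); last exact: mball_center.
exists x, r; split => //; apply/eqP; rewrite -measure_le0 -mu0.
by apply: le_measure; rewrite ?inE; [exact: measurable_mball..|exact: mball_openW].
Qed.

Lemma measurable_msupport : measurable (msupport mu : set (borel X)).
Proof.
apply: measurableC; apply: open_measurable_borel; apply: bigcup_open.
by move=> _ [x [r [_ -> _]]]; exact: open_mball.
Qed.

(** By tau-additivity the union of the null balls has the supremum of the measures of finite
    subunions, all of which are null. *)
Lemma msupportC0 : mu (~` msupport mu) = 0%E.
Proof.
have [_ tmu _] := amu; rewrite /msupport setCK tmu; last first.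
  by move=> _ [x [r [_ -> _]]]; exact: open_mball.
apply/eqP; rewrite eq_le; apply/andP; split; last first.
  apply: le_ereal_sup_tmp; exists 0%E => //; exists set0; last by rewrite bigcup_set0.
  by split.
apply: ge_ereal_sup => _ [D [/finite_seqP[s ->] sC] <-].
rewrite bigcup_seq.
have [_ ->//] : measurable (\big[setU/set0]_(i <- s) i : set (borel X)) /\
  mu (\big[setU/set0]_(i <- s) i) = 0%E.
rewrite big_seq; apply: (big_ind (fun A : set (borel X) => measurable A /\ mu A = 0%E)).
- by split => //; exact: measure0.
- by move=> A B [mA A0] [mB B0]; split; [exact: measurableU|exact: null_set_setU].
- by move=> _ /sC[x [r [_ -> ?]]]; split => //; exact: measurable_mball.
Qed.

Lemma sigma_finite_admissible : sigma_finite setT mu.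
Proof.
exists (fun n => mball OpenBalls (point : X) n%:R).
  apply/seteqP; split => // x _.
  exists (Num.truncn (mdist (point : X) x)).+1 => //=.
  by rewrite truncnS_gt.
by move=> n; split; [exact: measurable_mball|exact: mball_finite].
Qed.

(** Tau-additivity for the cover of [U] by the open sets [U n B(x, e)]: finitely many of them carry
    all of [mu U] up to [d]. *)
Lemma finite_net (U : set X) (e d : R) : open U -> (mu U < +oo)%E -> 0 < e -> 0 < d ->
  exists Q : set X, finite_set Q /\
    (mu U < mu (U `&` \bigcup_(q in Q) mball OpenBalls q e) + d%:E)%E.
Proof.
move=> oU Uoo e0 d0; have [_ tmu _] := amu.
pose C := range (fun x => U `&` mball OpenBalls x e).
have UC : U = \bigcup_(V in C) V.
  apply/seteqP; split=> [x Ux|x [_ [y _ <-] []]//].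
  by exists (U `&` mball OpenBalls x e); [exists x|split => //; exact: mball_center].
have : (mu U - d%:E < mu U)%E.
  by rewrite lteBlDr// lteDl ?lte_fin// ge0_fin_numE.
rewrite {2}UC tmu; last by move=> _ [x _ <-]; apply: openI => //; exact: open_mball.
move=> /ereal_sup_gt[_ [D [finD DC] <-]] UD.
pose sel V : X := xget point [set x | V = U `&` mball OpenBalls x e].
have selP V : D V -> V = U `&` mball OpenBalls (sel V) e.
  move=> /DC[x _ <-].
  by apply: (@xgetPex _ point [set z | _ = U `&` mball OpenBalls z e]); exists x.
exists (sel @` D); split; first exact: finite_image.
rewrite -lteBlDr//; apply: lt_le_trans UD _.
apply: le_measure; rewrite ?inE.
- apply: open_measurable_borel; apply: bigcup_open => V /DC[x _ <-].
  by apply: openI => //; exact: open_mball.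
- apply: open_measurable_borel; apply: openI => //; apply: bigcup_open => x _.
  exact: open_mball.
- move=> x [V DV]; rewrite (selP _ DV) => -[Ux xV]; split => //.
  by exists (sel V) => //; exists V.
Qed.

(** [Q] collects finite nets of the balls of radius [j] about [point], at scale [1 / (j + 1)] and
    missing mass less than [1 / (j + 1)]. A ball about a support point has positive mass, hence for
    large [j] it cannot lie in the missed part. *)
Lemma msupport_separable : exists Q : set X, countable Q /\
  forall x, msupport mu x -> forall e, 0 < e -> exists2 q, Q q & mdist x q < e.
Proof.
pose U j := mball OpenBalls (point : X) j%:R.
have /choice[Q QP] : forall j : nat, exists Q : set X, finite_set Q /\
    (mu (U j) < mu (U j `&` \bigcup_(q in Q) mball OpenBalls q j.+1%:R^-1)
      + j.+1%:R^-1%:E)%E.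
  move=> j; apply: finite_net; rewrite ?invr_gt0//; first exact: open_mball.
  exact: mball_finite.
exists (\bigcup_j Q j); split.
  by apply: bigcup_countable => // j _; apply: finite_set_countable; exact: (QP j).1.
move=> x xmu e e0; have e20 : 0 < e / 2 by rewrite divr_gt0.
have B0 := @msupport_mball_gt0 OpenBalls _ _ e20 xmu.
have Bfin : mu (mball OpenBalls x (e / 2)) \is a fin_num.
  by rewrite ge0_fin_numE ?measure_ge0// mball_finite.
set eta := fine (mu (mball OpenBalls x (e / 2))).
have eta0 : 0 < eta by rewrite fine_gt0// B0 -ge0_fin_numE// measure_ge0.
(* [1 / (j + 1) < m] makes both the missing mass smaller than that of [B(x, e / 2)] and the net
   finer than [e / 2]; the second term of [M] puts [B(x, e / 2)] inside [U j]. *)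
pose m := Num.min eta (e / 2).
have m0 : 0 < m by rewrite lt_min eta0.
pose M := Num.max m^-1 (mdist point x + e).
pose j := (Num.truncn M).+1.
have Mj : M < j%:R by rewrite truncnS_gt.
have jm : j.+1%:R^-1 < m.
  rewrite invf_plt ?posrE//; apply: (@le_lt_trans _ _ M); first by rewrite le_max lexx.
  by rewrite (lt_trans Mj)// ltr_nat.
have BU : mball OpenBalls x (e / 2) `<=` U j.
  move=> z /= xz; have := metric_triangle point x z.
  have : mdist point x + e < j%:R by apply: le_lt_trans Mj; rewrite le_max lexx orbT.
  rewrite /U /=; lra.
have [_] := QP j; set V := \bigcup_(q in _) _ => UV.
have mV : measurable (V : set (borel X)).
  by apply: open_measurable_borel; apply: bigcup_open => q _; exact: open_mball.
have mU : measurable (U j : set (borel X)) by exact: measurable_mball.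
have [z [xz [q Qq qz]]] : exists z, mball OpenBalls x (e / 2) z /\ V z.
  apply: contrapT => /forallNP xV; move: UV; apply/negP; rewrite -leNgt.
  have : (mu (mball OpenBalls x (e / 2)) <= mu (U j `\` V))%E.
    apply: le_measure; rewrite ?inE; [exact: measurable_mball|exact: measurableD|].
    by move=> z xz; split; [exact: BU|move=> Vz; exact: (xV z)].
  rewrite (measureDI mu mU mV) addeC.
  move=> h; apply: leeD => //; apply: le_trans h.
  by rewrite -(fineK Bfin) lee_fin (le_trans (ltW jm))// ge_min lexx.
exists q; first by exists j.
have := metric_triangle x z q; rewrite /= in xz qz; rewrite (metric_sym z q).
have : m <= e / 2 by rewrite ge_min lexx orbT.
move=> me /le_lt_trans; apply; rewrite [e]splitr; apply: ltrD => //.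
exact: lt_le_trans (lt_trans qz jm) me.
Qed.

End support.

(** * Tonelli's theorem and monotonicity of the integral *)

Section sigma_finite_tonelli.
Context d (T : measurableType d) (R : realType).
Variable mu : {measure set T -> \bar R}.
Hypothesis sfmu : sigma_finite setT mu.

(** The results on product measures are stated for bundled sigma-finite measures; [nu] is [mu] with
    this structure attached, and the two are convertible. *)
Let sfinite := isSFinite.Build _ _ _ _ (sfinite_measure_sigma_finite sfmu).
Let sigfinite := isSigmaFinite.Build _ _ _ _ sfmu.
Let nu : {sigma_finite_measure set T -> \bar R} :=
  HB.pack (Measure.sort mu) sfinite sigfinite.

Lemma sigma_finite_measurable_xsection (E : set (T * T)) : measurable E ->
  measurable_fun setT (fun x => mu (xsection E x)).
Proof. exact: (@measurable_fun_xsection _ _ _ _ _ nu). Qed.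

Lemma sigma_finite_tonelli (f : T * T -> \bar R) : measurable_fun setT f ->
  (forall p, 0 <= f p)%E ->
  (\int[mu]_x \int[mu]_y f (x, y) = \int[mu]_y \int[mu]_x f (x, y))%E.
Proof. exact: (@fubini_tonelli _ _ _ _ _ nu nu). Qed.

End sigma_finite_tonelli.

(* No measurability is needed, the integral of a nonnegative function being the
   supremum of the integrals of the simple functions below it. *)
Lemma ge0_le_integralT d (T : measurableType d) (R : realType)
    (mu : {measure set T -> \bar R}) (f1 f2 : T -> \bar R) :
  (forall x, 0 <= f1 x)%E -> (forall x, f1 x <= f2 x)%E ->
  (\int[mu]_x f1 x <= \int[mu]_x f2 x)%E.
Proof.
move=> f10 f12; rewrite !ge0_integralTE//; last by move=> x; exact: le_trans (f12 x).
by apply: ereal_sup_le => _ [h hf1 <-]; exists h => // x; exact: le_trans (f12 x).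
Qed.

(** * Measurability of the set of near pairs and of the inverse ball measure *)

Section pairs.
Context {R : realType} (X : pmetricType R).
Variable mu : {measure set (borel X) -> \bar R}.
Hypothesis amu : admissible mu.

(* When [X] is not separable, [[set p | mball k p.1 r p.2]] may fail to be
   measurable for the product of the Borel sigma-algebras; the support is
   separable. *)
Definition near_pairs k r : set (borel X * borel X) :=
  [set p | [/\ msupport mu p.1, msupport mu p.2 & mball k p.1 r p.2]].

(** For support points, [d(x, y) < r] holds iff some [q n] lies within [1 / (m + 1)] of [x] and
    within [r - 1 / (m + 1)] of [y]: a countable union of rectangles. *)
Lemma measurable_near_pairs_open r : measurable (near_pairs OpenBalls r).
Proof.
have [Q [/countable_injP[c cinj] Qd]] := msupport_separable amu.
(* An enumeration of [Q]. The default [point] is harmless: by the triangle inequality each rectangle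
   contains only pairs at distance less than [r], whatever its centre. *)
pose q n : X := xget point [set q | Q q /\ c q = n].
have qc x : Q x -> q (c x) = x.
  move=> Qx; have [Qq cq] : [set q | Q q /\ c q = c x] (q (c x)).
    by apply: (@xgetPex _ point [set q | Q q /\ c q = c x]); exists x.
  by apply: cinj; rewrite ?inE.
have -> : near_pairs OpenBalls r = (msupport mu `*` msupport mu) `&`
    \bigcup_n \bigcup_m (mball OpenBalls (q n) m.+1%:R^-1 `*`
                         mball OpenBalls (q n) (r - m.+1%:R^-1)).
  apply/seteqP; split => [[x y] /= [xmu ymu xy]|[x y] [[xmu ymu]]].
    split=> //; have [m] : exists m : nat, 0 + m.+1%:R^-1 < (r - mdist x y) / 2.
      by apply: ltr_add_invr; rewrite divr_gt0// subr_gt0.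
    rewrite add0r; set e := m.+1%:R^-1 => me.
    have e0 : 0 < e by rewrite invr_gt0.
    have [z Qz xz] := Qd x xmu _ e0.
    exists (c z) => //; exists m => //; split; rewrite /= qc// -/e (metric_sym z)//.
    by have := metric_triangle y x z; rewrite (metric_sym y x); lra.
  move=> [n _ [m _ [/= xq yq]]]; split => //=.
  have := metric_triangle x (q n) y; rewrite (metric_sym x (q n)).
  by move: (m.+1%:R^-1) xq yq => e; lra.
have mS := measurable_msupport mu.
apply: measurableI; first exact: (measurableX mS mS).
do 2 apply: bigcupT_measurable => ?.
apply: measurableX; exact: measurable_mball.
Qed.

Lemma measurable_near_pairs k r : measurable (near_pairs k r).
Proof.
case: k; first exact: measurable_near_pairs_open.
have -> : near_pairs ClosedBalls r = \bigcap_n near_pairs OpenBalls (r + n.+1%:R^-1).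
  apply/seteqP; split => [[x y] [xmu ymu xy] n _|[x y] h].
    by split => //; move: xy; rewrite closed_mballE; exact.
  have [xmu ymu _] := h 0%N I; split => //; rewrite closed_mballE => n _.
  by have [] := h n I.
by apply: bigcap_measurable => // n _; exact: measurable_near_pairs_open.
Qed.

Lemma xsection_near_pairs k r x : msupport mu x ->
  xsection (near_pairs k r) x = msupport mu `&` mball k x r.
Proof.
move=> xmu; apply/seteqP; split => y; rewrite /xsection /= ?inE => - [] //.
Qed.

Lemma mu_setI_msupport (A : set (borel X)) : measurable A ->
  mu (msupport mu `&` A) = mu A.
Proof.
move=> mA; have mS := measurable_msupport mu.
rewrite -[in RHS](setIT A) -(setUv (msupport mu)) setIUr measureU0.
- by rewrite setIC.
- exact: measurableI.
- by apply: measurableI => //; exact: measurableC.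
- by apply: subset_measure0 (msupportC0 amu); [|exact: measurableC|exact: subIsetr]; 
   apply: measurableI => //; exact: measurableC.
Qed.

(* Taking sections makes the measurability in [x] available; on the support this
   is the inverse of [mu (mball k x r)], see [inv_mballE]. *)
Definition inv_mball k r (x : borel X) : R :=
  (fine (mu (xsection (near_pairs k r) x)))^-1.

Lemma inv_mball_ge0 k r x : 0 <= inv_mball k r x.
Proof. by rewrite invr_ge0 fine_ge0. Qed.

Lemma measurable_mu_xsection k r :
  measurable_fun setT (fun x => mu (xsection (near_pairs k r) x)).
Proof.
apply: sigma_finite_measurable_xsection; last exact: measurable_near_pairs.
exact: sigma_finite_admissible.
Qed.

Lemma mu_xsection k r x : msupport mu x ->
  mu (xsection (near_pairs k r) x) = mu (mball k x r).
Proof.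
move=> xmu; rewrite xsection_near_pairs// mu_setI_msupport//.
exact: measurable_mball.
Qed.

Lemma measurable_inv_mball k r : measurable_fun setT (inv_mball k r).
Proof.
(* The inverse as a power, whose measurability is known; the two agree at 0 as well, where both are
   0. *)
apply: (eq_measurable_fun (fun x => (fine (mu (xsection (near_pairs k r) x))) `^ (-1))).
  by move=> x _; rewrite powR_inv1// fine_ge0.
apply: (measurableT_comp (measurable_powR _)).
apply: measurableT_comp; first exact: fine_measurable.
exact: measurable_mu_xsection.
Qed.

Lemma inv_mballE k r x : 0 < r -> msupport mu x ->
  (mu (mball k x r))^-1%E = (inv_mball k r x)%:E.
Proof.
move=> r0 xmu; rewrite /inv_mball mu_xsection//.
have B0 := msupport_mball_gt0 k r0 xmu.
have Bf : mu (mball k x r) \is a fin_num.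
  by rewrite ge0_fin_numE ?measure_ge0// mball_finite.
rewrite -{1}(fineK Bf) inver gt_eqF// fine_gt0// B0 -ge0_fin_numE//.
Qed.

End pairs.

(** * The integral of the inverse ball measure over a ball *)

Section kernel.
Context {R : realType} (X : pmetricType R).
Variable mu : {measure set (borel X) -> \bar R}.
Hypothesis amu : admissible mu.
Variables (k : ball_kind) (r : R).
Hypothesis r0 : 0 < r.

Let w := inv_mball mu k r.

Let m x := fine (mu (mball k x r)).

Let mE x : mu (mball k x r) = (m x)%:E.
Proof. by rewrite fineK// ge0_fin_numE ?measure_ge0// mball_finite. Qed.

Let wE x : msupport mu x -> w x = (m x)^-1.
Proof. by move=> xmu; rewrite /w /inv_mball mu_xsection. Qed.

Let m_gt0 x : msupport mu x -> 0 < m x.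
Proof. by move=> xmu; have := msupport_mball_gt0 k r0 xmu; rewrite mE. Qed.

Let mw A : measurable_fun (A : set (borel X)) (EFin \o w).
Proof.
apply/measurable_EFinP; apply: measurable_funTS.
exact: measurable_inv_mball.
Qed.

Lemma near_minimal_mball (A : set X) (d e : R) : A !=set0 -> 0 < d -> 0 < e ->
  (forall x, A x -> d <= m x) ->
  exists2 x, A x & forall z, A z -> m x <= (1 + e) * m z.
Proof.
move=> [a Aa] d0 e0 dm.
have infm : has_inf (m @` A).
  by split; [exists (m a), a|exists d => _ [x /dm ? <-]].
have i0 : 0 < inf (m @` A).
  by apply: lt_le_trans d0 _; apply: lb_le_inf; [exact: infm.1|move=> _ [x /dm ? <-]].
(* The infimum being positive, the slack can be [e] times it, which makes the error
   multiplicative. *)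
have [_ [x Ax <-] xi] := inf_adherent (mulr_gt0 e0 i0) infm.
exists x => // z Az; apply: (le_trans (ltW xi)).
rewrite -[X in X + _]mul1r -mulrDl ler_pM2l ?addr_gt0//.
by apply: ge_inf; [exact: infm.2|exists z].
Qed.

(* The lower bound [d] allows to pick near-minimizers of the measure of the
   balls, which may otherwise have infimum 0. *)
Lemma integral_inv_mball_le n (A : set (borel X)) (d e : R) :
  measurable A -> A `<=` msupport mu -> 0 < d -> 0 < e ->
  (forall x, A x -> d <= m x) ->
  (forall s : seq X, besicovitch_centers k r s -> {in s, forall x, A x} ->
    (size s <= n)%N) ->
  (\int[mu]_(x in A) (w x)%:E <= (n%:R * (1 + e))%:E)%E.
Proof.
move=> + + d0 e0; have e10 : 0 < 1 + e by rewrite addr_gt0.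
elim: n A => [|n IHn] A mA Amu dm As;
  (have [->|/set0P A0] := eqVneq A set0;
   first by rewrite integral_set0 lee_fin mulr_ge0// ltW).
  (* For [n = 0] the set is empty, since any of its points alone is a separated family. *)
  have [x Ax] := A0; suff : (size [:: x] <= 0)%N by [].

  apply: As; first by split => // y z; rewrite !inE => /eqP -> /eqP ->.
  by move=> y; rewrite inE => /eqP ->.
have [x Ax xmin] := near_minimal_mball A0 d0 e0 dm.
have mx := m_gt0 (Amu _ Ax).
have mB : measurable (mball k x r : set (borel X)) by exact: measurable_mball.
have mAB : measurable (A `&` mball k x r) by exact: measurableI.
(* On [A n B(x, r)] the integrand is at most [(1 + e) / m x], so this piece contributes at most
   [1 + e]; the rest of [A] is left to the induction. *)
rewrite -[A in leLHS](setUIDK A (mball k x r)).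
rewrite ge0_integral_setU//=; first last.
- by apply/disj_setPS => z [[_ ?] []].
- by move=> z _; rewrite lee_fin inv_mball_ge0.
- exact: measurableD.
rewrite -[in leRHS]natr1 mulrDl mul1r EFinD [leRHS]addeC; apply: leeD.
  apply: (@le_trans _ _ (\int[mu]_(z in A `&` mball k x r) ((1 + e) / m x)%:E)%E).
    apply: ge0_le_integral => //.
    - by move=> z _; rewrite lee_fin inv_mball_ge0.
    - by move=> z [Az _]; rewrite lee_fin wE ?ler_pdivlMr ?ler_pdivrMl// ?m_gt0//;
        [rewrite mulrC; exact: xmin|exact: Amu|exact: Amu].
  rewrite integral_cst//.
  apply: (@le_trans _ _ (((1 + e) / m x)%:E * mu (mball k x r))%E).
    apply: lee_wpmul2l; first by rewrite lee_fin divr_ge0 ?ltW.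
    by apply: le_measure; rewrite ?inE// ; exact: subIsetr.
  by rewrite mE -EFinM divfK// gt_eqF.
apply: IHn.
- exact: measurableD.
- by move=> z [/Amu].
- by move=> z [/dm].
(* A separated family outside [B(x, r)] stays separated when [x] is added, so its size is at most
   [n]. *)
move=> s [us seps] sA; rewrite -ltnS.
apply: (As (x :: s)).
  split=> /=.
    rewrite us andbT; apply/negP => /sA[_]; apply; exact: mball_center.
  move=> y z; rewrite !inE => /predU1P[->|ys] /predU1P[->|zs] //.
  - by case/sA: zs.
  - by move/mball_sym; case/sA: ys.
  - exact: seps.
by move=> y; rewrite inE => /predU1P[->//|/sA[]].
Qed.

(** Monotone convergence along the sets [F n] where the balls have mass at least [1 / (n + 1)],
    which supplies the lower bound that [integral_inv_mball_le] asks for. Every point of the support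
    lies in some [F n]. *)
Lemma integral_inv_mball_near_le (S : R) (y : X) :
  (forall s : seq X, besicovitch_centers k r s -> {in s, forall x, mball k x r y} ->
    (size s)%:R <= S) ->
  (\int[mu]_(x in msupport mu `&` mball k y r) (w x)%:E <= S%:E)%E.
Proof.
move=> sS.
have S0 : 0 <= S by apply: (sS [::]).
pose G := msupport mu `&` mball k y r.
have mS := measurable_msupport mu.
have mG : measurable (G : set (borel X)).
  by apply: measurableI => //; exact: measurable_mball.
pose F n : set (borel X) :=
  G `&` [set x | (n.+1%:R^-1%:E <= mu (xsection (near_pairs mu k r) x))%E].
have mF n : measurable (F n).
  apply: emeasurable_fun_c_infty => //; apply: measurable_funTS.
  exact: measurable_mu_xsection.
have FG : \bigcup_n F n = G.
  apply/seteqP; split => [x [n _ []]//|x Gx].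
  have [n] := ltr_add_invr (m_gt0 Gx.1); rewrite add0r => nx.
  by exists n => //; split => //=; rewrite mu_xsection ?mE ?lee_fin ?ltW//; exact: Gx.1.
have ndF : nondecreasing_seq F.
  move=> i j ij; apply/subsetPset => x [Gx /= ix]; split => //=.
  apply: le_trans ix; rewrite lee_fin lef_pV2 ?posrE//.
  by rewrite ler_nat ltnS.
have FS n : (\int[mu]_(x in F n) (w x)%:E <= S%:E)%E.
  apply/lee_addgt0Pr => e e0.
  (* Chosen so that [S * (1 + e / (S + 1)) <= S + e]; the added 1 covers [S = 0]. *)
  have e1 : 0 < e / (S + 1) by rewrite divr_gt0// ltr_wpDl.
  apply: (@le_trans _ _ ((Num.truncn S)%:R * (1 + e / (S + 1)))%:E).
    apply: (@integral_inv_mball_le _ _ n.+1%:R^-1) => //.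
    - by move=> x [[]].
    - move=> x [[xmu _]] /=; rewrite mu_xsection// mE lee_fin//.
    - move=> s seps sF; rewrite truncn_ge_nat//; apply: sS => // x /sF[[_ yx] _].
      exact: mball_sym.
  rewrite -EFinD lee_fin; apply: (@le_trans _ _ (S * (1 + e / (S + 1)))).
    by rewrite ler_wpM2r ?truncn_le// addr_ge0// ltW.
  rewrite mulrDr mulr1 lerD2l mulrCA; apply: ler_piMr; first exact: ltW.
  by rewrite ler_pdivrMr ?mul1r ?lerDl// ltr_wpDl.
rewrite -/G -FG.
have cvgF := ge0_nondecreasing_set_cvg_integral (mu := mu) ndF mF
  (fun i => @mw (F i)) (fun i x _ => inv_mball_ge0 mu k r x).
rewrite -(cvg_lim _ cvgF)//; apply: lime_le.
  by apply/cvg_ex; eexists; exact: cvgF.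
by apply: nearW => n; exact: FS.
Qed.

End kernel.

(** * The strong-type bound for the averages *)

Section average_norm_le.
Context {R : realType} (X : pmetricType R).
Variable mu : {measure set (borel X) -> \bar R}.
Hypothesis amu : admissible mu.
Variables (k : ball_kind) (r S : R).
Hypothesis r0 : 0 < r.
Hypothesis sS : forall (y : X) (s : seq X), besicovitch_centers k r s ->
  {in s, forall x, mball k x r y} -> (size s)%:R <= S.

Let w := inv_mball mu k r.
Let Z : set (borel X) := msupport mu.

Let mZ : measurable Z. Proof. exact: measurable_msupport. Qed.

Let S0 : 0 <= S.
Proof. by apply: (@sS point [::]). Qed.

Section fixed_function.
Variable g : borel X -> R.
Hypothesis ig : mu.-integrable setT (EFin \o g).

Let f (p : borel X * borel X) : \bar R :=
  (\1_(near_pairs mu k r) p * w p.1 * `|g p.2|)%:E.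

Let f0 p : (0 <= f p)%E.
Proof. by rewrite lee_fin !mulr_ge0// ?indicE// inv_mball_ge0. Qed.

Let mg : measurable_fun setT g.
Proof. by apply/measurable_EFinP; have /integrableP[] := ig. Qed.

Let mf : measurable_fun setT f.
Proof.
apply/measurable_EFinP; apply: measurable_funM; first apply: measurable_funM.
- by apply: measurable_indic; exact: measurable_near_pairs.
- exact: (measurableT_comp (measurable_inv_mball amu k r) measurable_fst).
- apply: (measurableT_comp (@normr_measurable R setT)).
  exact: (measurableT_comp mg measurable_snd).
Qed.

Lemma norm_average_le x : Z x ->
  (`|average k mu r g x| <= \int[mu]_y f (x, y))%E.
Proof.
move=> Zx; have mB : measurable (mball k x r : set (borel X)) by exact: measurable_mball.
have mgB : measurable_fun (mball k x r : set (borel X)) (EFin \o g).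
  by apply/measurable_EFinP; exact: measurable_funTS.
have -> : (\int[mu]_y f (x, y) = (w x)%:E * \int[mu]_(y in mball k x r) `|(g y)%:E|)%E.
  (* [f] vanishes when [y] is off the support; the same null set is removed from the ball on the
     right. *)
  rewrite [in RHS](ge0_negligible_integral _ _ _ _ (msupportC0 amu))//; last 2 first.
  - by apply: measurableC.
  - exact: (measurableT_comp (@abse_measurable R setT) mgB).
  rewrite -ge0_integralZl//; last 3 first.
  - by apply: measurableD => //; exact: measurableC.
  - by apply: measurableT_comp => //; apply: measurable_funS mgB.
  - by rewrite lee_fin inv_mball_ge0.
  rewrite [RHS]integral_mkcond; apply: eq_integral => y _.
  rewrite /f /= patchE indicE.
  have -> : ((x, y) \in near_pairs mu k r) = (y \in mball k x r `\` ~` Z).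
    rewrite /near_pairs; apply/idP/idP => /set_mem/= h; apply/mem_set.
      by case: h => _ ymu xy; split => //; apply.
    by case: h => xy /contrapT ymu; split.
  by case: ifP => _; rewrite ?mul1r ?mul0r ?EFinM.
rewrite /average abseM inv_mballE// gee0_abs ?lee_fin ?inv_mball_ge0//.
apply: lee_wpmul2l; first by rewrite lee_fin inv_mball_ge0.
exact: le_abse_integral.
Qed.

(** By symmetry of the distance, the [x] that pair with a support point [y] fill [Z n B(y, r)],
    where [integral_inv_mball_near_le] bounds the integral of [w]. *)
Lemma integral_section_le y : (\int[mu]_x f (x, y) <= S%:E * `|g y|%:E)%E.
Proof.
have [Zy|nZy] := pselect (Z y); last first.
  rewrite integral0_eq ?mule_ge0 ?lee_fin// => x _.
  by rewrite /f indicE memNset ?mul0r//; case.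
have -> : (\int[mu]_x f (x, y) =
    \int[mu]_(x in Z `&` mball k y r) (w x)%:E * `|g y|%:E)%E.
  rewrite -ge0_integralZr//; last 3 first.
  - by apply: measurableI => //; exact: measurable_mball.
  - by apply: measurable_funTS; apply/measurable_EFinP; exact: measurable_inv_mball.
  - by move=> x _; rewrite lee_fin inv_mball_ge0.
  rewrite [RHS]integral_mkcond; apply: eq_integral => x _; rewrite /f /= patchE indicE.
  have -> : ((x, y) \in near_pairs mu k r) = (x \in Z `&` mball k y r).
    apply/idP/idP => /set_mem/= h; apply/mem_set.
      by case: h => xmu _ xy; split => //; exact: mball_sym.
    by case: h => xmu yx; split => //; exact: mball_sym.
  by case: ifP => _; rewrite ?mul1r ?mul0r ?EFinM.
by apply: lee_wpmul2r; rewrite ?lee_fin//; exact: integral_inv_mball_near_le (@sS y).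
Qed.

Lemma Lnorm_average_le :
  ('N[mu]_1[(average k mu r g : borel X -> \bar R) \_ Z]
     <= S%:E * 'N[mu]_1[EFin \o g])%E.
Proof.
rewrite !Lnorm1; apply: (@le_trans _ _ (\int[mu]_x \int[mu]_y f (x, y))%E).
  (* The average itself is not shown to be measurable, hence this form of monotonicity. *)
  apply: ge0_le_integralT => // x.
  rewrite patchE; case: ifPn => [/set_mem|_]; first exact: norm_average_le.
  by rewrite abse0 integral_ge0.
rewrite (sigma_finite_tonelli (sigma_finite_admissible amu))//.
rewrite -ge0_integralZl//; last first.
  by apply: measurableT_comp => //; apply/measurable_EFinP.
by apply: ge0_le_integralT => y; [exact: integral_ge0|exact: integral_section_le].
Qed.

End fixed_function.

Lemma average_norm_le : (average_norm k mu r <= S%:E)%E.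
Proof.
apply: ereal_inf_lbound; exists S => //; split => // g ig.
exact: Lnorm_average_le.
Qed.

End average_norm_le.

(** * Comparison of the two suprema *)

Theorem corollary2p12 (R : realType) (X : pmetricType R)
    (hX : exists x y : X, x != y) (k : ball_kind) :
  (ereal_sup [set average_norm k mu r | r in [set r : R | (0 < r)%R]
                                      & mu in @admissible R X]
   <= ereal_sup [set maximal_weak_norm k mu | mu in @admissible R X])%E.
Proof.
apply: ge_ereal_sup => _ [r r0 [mu amu <-]].
set M := ereal_sup _.
have muM nu : @admissible R X nu -> (maximal_weak_norm k nu <= M)%E.
  by move=> anu; apply: ereal_sup_ubound; exists nu.
(* The measure [mu] at hand rules out [M = -oo]; for [M = +oo] the bound is trivial, which leaves a
   real [M]. *)
have M0 : (0 <= M)%E.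
  apply: le_trans (muM _ amu); apply: le_ereal_inf_tmp => _ [c [c0 _] <-].
  by rewrite lee_fin.
move: M0 muM; case: M => [S _ muS|_ _|//]; last exact: leey.
apply: average_norm_le => // y s; exact: (besicovitch_centers_size_le hX muS).
Qed.
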